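(* Suppose that $\mathbf S = (S, \leq, \sqsubseteq)$ is a specialization poset, $b \in S$ and the set $\{a \in S \mid a \sqsubseteq b\}$ has a maximum (in the sense of $\leq$). Call this maximum $Kb$. Then, for every $a \in S$, the following conditions are equivalent. (i) $a \sqsubseteq b$; (ii) $a \leq Kb$; (iii) $a \sqsubseteq Kb$. In particular, $Kb$ is also the maximum of $\{a \in S \mid a \sqsubseteq Kb\}$; that is, if $Kb$ exists, then $KKb$ exists, too, and they are equal. Suppose further that $a \in S$ and the set $\{c \in S \mid c \sqsubseteq a\}$ has a maximum, call it $Ka$. Then conditions (i)–(iii) above are also equivalent to (iv) $Ka \leq Kb$; (v) $Ka \sqsubseteq Kb$.
   Context: A specialization poset is a structure $(S, \leq, \sqsubseteq)$ such that $(S, \leq)$ is a partially ordered set and $\sqsubseteq$ is a binary relation on $S$ satisfying, for all $a,b,c \in S$: (S1) $a \leq b$ implies $a \sqsubseteq b$; (S2) $a \sqsubseteq b$ and $b \sqsubseteq c$ imply $a \sqsubseteq c$. *)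

(* Defs.v *)
From Stdlib Require Import Relation_Definitions.

(** The order is a relation in [Prop] rather than a boolean one, so that
    arbitrary (not necessarily decidable) posets are covered. *)
Record specialization_poset : Type := SpecializationPoset {
  carrier :> Type;
  le : relation carrier;
  spec : relation carrier;
  le_order : order carrier le;
  le_spec : forall a b : carrier, le a b -> spec a b;
  spec_trans : forall a b c : carrier, spec a b -> spec b c -> spec a c
}.

Arguments le {s} _ _.
Arguments spec {s} _ _.

Declare Scope spec_scope.
Delimit Scope spec_scope with spec.
Notation "a <= b" := (le a b) : spec_scope.
Notation "a [= b" := (spec a b) (at level 70, no associativity) : spec_scope.
Open Scope spec_scope.

(** Greatest element, not merely a maximal one. *)
Definition is_maximum {S : specialization_poset} (A : S -> Prop) (m : S) : Prop :=
  A m /\ forall x : S, A x -> x <= m.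

(** [K] is a partial operation, rendered by its graph: [is_K b k] says that
    [K b] exists and equals [k]. *)
Definition is_K {S : specialization_poset} (b k : S) : Prop :=
  is_maximum (fun a : S => a [= b) k.

(* Main.v *)
Require Import Defs.
From Stdlib Require Import Relation_Definitions.

(** When [Kb] exists, the down-set of [b] for [spec] is the principal down-set of
    [Kb] for [le]. Moreover [b] and [Kb] are interchangeable on the right of
    [spec]: [spec Kb b] holds by membership, and [spec b Kb] holds because [b] belongs
    to the set of which [Kb] is the greatest element. Hence [b] and [Kb] have
    the same down-set for [spec], with the same maximum [Kb], which gives
    [KKb = Kb]. When [Ka] exists, [a] and [Ka] are likewise interchangeable on
    the left of [spec], so the conditions on [Ka] are those on [a]. *)

Lemma le_reflexive (S : specialization_poset) (a : S) : a <= a.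
Proof. exact (ord_refl _ _ (le_order S) a). Qed.

Lemma le_antisymmetric (S : specialization_poset) (a b : S) :
  a <= b -> b <= a -> a = b.
Proof. exact (ord_antisym _ _ (le_order S) a b). Qed.

Lemma is_maximum_unique (S : specialization_poset) (A : S -> Prop) (m n : S) :
  is_maximum A m -> is_maximum A n -> m = n.
Proof.
  intros [Am Hm] [An Hn].
  exact (le_antisymmetric S m n (Hn m Am) (Hm n An)).
Qed.

Lemma K_le (S : specialization_poset) (b Kb : S) : is_K b Kb -> b <= Kb.
Proof. intros [_ H]. apply H, le_spec, le_reflexive. Qed.

Lemma spec_iff_le_K (S : specialization_poset) (a b Kb : S) :
  is_K b Kb -> (a [= b <-> a <= Kb).
Proof.
  intros [HKb Hmax]; split.
  - apply Hmax.
  - intro H. exact (spec_trans S a Kb b (le_spec S a Kb H) HKb).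
Qed.

Lemma spec_iff_spec_K (S : specialization_poset) (a b Kb : S) :
  is_K b Kb -> (a [= b <-> a [= Kb).
Proof.
  intros HK; split; intro H.
  - exact (spec_trans S a b Kb H (le_spec S b Kb (K_le S b Kb HK))).
  - exact (spec_trans S a Kb b H (proj1 HK)).
Qed.

Lemma K_spec_iff_spec (S : specialization_poset) (a Ka c : S) :
  is_K a Ka -> (Ka [= c <-> a [= c).
Proof.
  intros HK; split; intro H.
  - exact (spec_trans S a Ka c (le_spec S a Ka (K_le S a Ka HK)) H).
  - exact (spec_trans S Ka a c (proj1 HK) H).
Qed.

Lemma is_K_idempotent (S : specialization_poset) (b Kb : S) :
  is_K b Kb -> is_K Kb Kb.
Proof.
  intro HK; split.
  - apply le_spec, le_reflexive.
  - intros x Hx.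
    apply (spec_iff_le_K S x b Kb HK), (spec_iff_spec_K S x b Kb HK), Hx.
Qed.

Theorem lemma5p1 (S : specialization_poset) (b Kb : S) (hKb : is_K b Kb) :
  (forall a : S,
      (a [= b <-> a <= Kb) /\
      (a <= Kb <-> a [= Kb)) /\
  (is_K Kb Kb /\ forall KKb : S, is_K Kb KKb -> KKb = Kb) /\
  (forall a Ka : S, is_K a Ka ->
      (a [= b <-> a <= Kb) /\
      (a <= Kb <-> a [= Kb) /\
      (a [= Kb <-> Ka <= Kb) /\
      (Ka <= Kb <-> Ka [= Kb)).
Proof.
  pose proof (fun x => spec_iff_le_K S x b Kb hKb) as Hle.
  pose proof (fun x => spec_iff_spec_K S x b Kb hKb) as Hspec.
  pose proof (is_K_idempotent S b Kb hKb) as HKK.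
  split; [| split; [split |]].
  - intro a. specialize (Hle a). specialize (Hspec a). tauto.
  - exact HKK.
  - intros KKb H. exact (is_maximum_unique S _ KKb Kb H HKK).
  - intros a Ka hKa.
    pose proof (K_spec_iff_spec S a Ka Kb hKa) as Hleft.
    pose proof (Hle a). pose proof (Hspec a).
    pose proof (Hle Ka). pose proof (Hspec Ka). tauto.
Qed.
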